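(* Let $(\mathcal C,T,E,R,\Rightarrow,d)$ be a setting for stability such that $R$ has local suprema and the supremum commutes with whiskering. Let $\phi\colon T\times E\to E$ be a $T$-flow and let $x^*\colon 1\to E$ be an equilibrium point of $\phi$. If $x^*$ is a stable equilibrium point, then there exists a Lyapunov morphism $V\colon E\to R$ for $\phi$ with equilibrium point $x^*$.
   Context: Setting for stability. It consists of: a category $\mathcal C$ with all finite products (terminal object $1$; $!\colon X\to 1$ denotes the unique morphism); an object $E$; an internal monoid $(T,\oplus\colon T\times T\to T,0_\oplus\colon 1\to T)$ in $\mathcal C$; a posetal object $R$, meaning that for every object $X$ the hom-set $\mathcal C(X,R)$ carries a partial order such that $g_1\ge g_2$ in $\mathcal C(Y,R)$ implies $g_1\circ f\ge g_2\circ f$ for every $f\colon X\to Y$; a point $0_R\colon 1\to R$; and a morphism $d\colon E\times E\to R$. For any $X$ write $0\colon X\xrightarrow{!}1\xrightarrow{0_R}R$. It is required that $d\ge 0$ in $\mathcal C(E\times E,R)$ and that the diagonal $\Delta\colon E\to E\times E$ is an equalizer of $d$ and $0$. One writes $g_1\Rightarrow g_2$ for $g_1\ge g_2$. Norm. For $x^*\colon 1\to E$, $\|\cdot\|_{x^*}:=d\circ(\mathrm{id}_E,\,x^*\circ !)\colon E\to R$. Class $\mathcal K$. A morphism $\alpha\colon R\to R$ is order-preserving if $f\ge g$ in $\mathcal C(X,R)$ implies $\alpha\circ f\ge\alpha\circ g$, for all $X$. It is of class $\mathcal K$ if it is order-preserving, has an order-preserving inverse $\alpha^{-1}$, and $\alpha\circ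 0_R=0_R$. Flow and equilibrium. A $T$-flow on $E$ is a left action $\phi\colon T\times E\to E$ of the monoid $T$: $\phi\circ(0_\oplus\circ !,\mathrm{id}_E)=\mathrm{id}_E$ and $\phi\circ(\oplus\times\mathrm{id}_E)=\phi\circ(\mathrm{id}_T\times\phi)$. A point $x^*\colon 1\to E$ is an equilibrium point of $\phi$ if $\phi\circ(\mathrm{id}_T,x^*\circ !)=x^*\circ !\colon T\to E$. Stable. An equilibrium point $x^*$ is stable if there is a class $\mathcal K$ morphism $\alpha$ with $\alpha\circ\|\cdot\|_{x^*}\circ\pi_E\ \ge\ \|\cdot\|_{x^*}\circ\phi$ in $\mathcal C(T\times E,R)$, where $\pi_E\colon T\times E\to E$ is the projection. Lyapunov morphism. A morphism $V\colon E\to R$ is a Lyapunov morphism for $\phi$ with equilibrium point $x^*$ if (1) (positive definite) there are class $\mathcal K$ morphisms $\underline\alpha,\overline\alpha$ with $\overline\alpha\circ\|\cdot\|_{x^*}\ge V\ge\underline\alpha\circ\|\cdot\|_{x^*}$, and (2) (decrescent) $V\circ\pi_E\ge V\circ\phi$ in $\mathcal C(T\times E,R)$. Local suprema. For objects $A,B$ and $f\colon A\times B\to R$, an upper-bound for $A$ of $f$ is a morphism $\beta\colon B\to R$ with $\beta\circ\pi_B\ge f$ in $\mathcal C(A\times B,R)$. $R$ has local suprema if, for all $A,B$, whenever $f\colon A\times B\to R$ has an upper-bound for $A$, it has a least one, denoted $\sup_A f\colon B\to R$; that is, $\sup_A f$ is an upper-bound for $A$ of $f$ and $\beta\ge\sup_A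 f$ for every upper-bound $\beta$ for $A$ of $f$. The supremum commutes with whiskering if, for every $f\colon A\times B\to R$ having an upper-bound for $A$ and every $r\colon C\to B$, $(\sup_A f)\circ r=\sup_A\bigl(f\circ(\mathrm{id}_A\times r)\bigr)$. *)

(* Defs.v *)
From Stdlib Require Import Relation_Definitions.

Set Implicit Arguments.
Unset Strict Implicit.
Unset Printing Implicit Defensive.

Declare Scope cat_scope.
Delimit Scope cat_scope with cat.
Local Open Scope cat_scope.

Record category := Category {
  obj :> Type;
  hom : obj -> obj -> Type;
  idm : forall X, hom X X;
  comp : forall X Y Z, hom Y Z -> hom X Y -> hom X Z;
  comp_idl : forall X Y (f : hom X Y), comp (idm Y) f = f;
  comp_idr : forall X Y (f : hom X Y), comp f (idm X) = f;
  comp_assoc : forall W X Y Z (h : hom Y Z) (g : hom X Y) (f : hom W X),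
    comp h (comp g f) = comp (comp h g) f
}.

Arguments hom {c} X Y.
Arguments idm {c} X.
Arguments comp {c X Y Z} g f : rename.

Notation "g \o f" := (comp g f)
  (at level 50, left associativity, format "g  \o  f") : cat_scope.

(* Finite products are given as a chosen terminal object and chosen binary
   products. *)
Record fp_category := FpCategory {
  fp_cat :> category;
  term : fp_cat;
  bang : forall X : fp_cat, hom X term;
  bang_uniq : forall (X : fp_cat) (f : hom X term), f = bang X;
  prodo : fp_cat -> fp_cat -> fp_cat;
  pr1 : forall A B, hom (prodo A B) A;
  pr2 : forall A B, hom (prodo A B) B;
  pair : forall X A B, hom X A -> hom X B -> hom X (prodo A B);
  pr1_pair : forall X A B (f : hom X A) (g : hom X B),
    pr1 A B \o pair f g = f;
  pr2_pair : forall X A B (f : hom X A) (g : hom X B),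
    pr2 A B \o pair f g = g;
  pair_uniq : forall X A B (f : hom X A) (g : hom X B) (h : hom X (prodo A B)),
    pr1 A B \o h = f -> pr2 A B \o h = g -> h = pair f g
}.

Arguments term {f} : rename.
Arguments bang {f} X : rename.
Arguments prodo {f} A B : rename.
Arguments pr1 {f} A B : rename.
Arguments pr2 {f} A B : rename.
Arguments pair {f X A B} g h : rename.

Notation "A \x B" := (prodo A B)
  (at level 40, left associativity) : cat_scope.

Definition prodm (C : fp_category) (A A' B B' : C)
    (f : hom A A') (g : hom B B') : hom (A \x B) (A' \x B') :=
  pair (f \o pr1 A B) (g \o pr2 A B).

Definition assoc (C : fp_category) (A B D : C) :
    hom ((A \x B) \x D) (A \x (B \x D)) :=
  pair (pr1 A B \o pr1 (A \x B) D)
       (pair (pr2 A B \o pr1 (A \x B) D) (pr2 (A \x B) D)).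

Definition diag (C : fp_category) (A : C) : hom A (A \x A) :=
  pair (idm A) (idm A).

Definition is_equalizer (C : category) (Q A B : C)
    (e : hom Q A) (f g : hom A B) : Prop :=
  f \o e = g \o e /\
  forall (X : C) (h : hom X A), f \o h = g \o h ->
    exists! k : hom X Q, e \o k = h.

Record internal_monoid (C : fp_category) := InternalMonoid {
  mon_obj :> C;
  mon_mul : hom (mon_obj \x mon_obj) mon_obj;
  mon_unit : hom term mon_obj;
  mon_assoc :
    mon_mul \o prodm mon_mul (idm mon_obj)
    = mon_mul \o prodm (idm mon_obj) mon_mul \o assoc mon_obj mon_obj mon_obj;
  mon_unitl :
    mon_mul \o pair (mon_unit \o bang mon_obj) (idm mon_obj) = idm mon_obj;
  mon_unitr :
    mon_mul \o pair (idm mon_obj) (mon_unit \o bang mon_obj) = idm mon_obj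
}.

Arguments mon_mul {C} i : rename.
Arguments mon_unit {C} i : rename.

Record posetal_object (C : category) := PosetalObject {
  pos_obj :> C;
  ge : forall X : C, relation (hom X pos_obj);
  ge_order : forall X : C, order (hom X pos_obj) (@ge X);
  ge_precomp : forall (X Y : C) (g1 g2 : hom Y pos_obj) (f : hom X Y),
    ge g1 g2 -> ge (g1 \o f) (g2 \o f)
}.

Arguments ge {C p X} g1 g2 : rename.

Notation "g1 >== g2" := (ge g1 g2) (at level 70, no associativity) : cat_scope.

Definition zero_mor (C : fp_category) (R : C) (zeroR : hom term R) (X : C) :
    hom X R :=
  zeroR \o bang X.

Record stability_setting := StabilitySetting {
  sC :> fp_category;
  sT : internal_monoid sC;
  sE : sC;
  sR : posetal_object sC;
  szero : hom term sR;
  sd : hom (sE \x sE) sR;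
  sd_ge0 : sd >== zero_mor szero (sE \x sE);
  sd_equalizer : is_equalizer (diag sE) sd (zero_mor szero (sE \x sE))
}.

Arguments sT : clear implicits.
Arguments sE : clear implicits.
Arguments sR : clear implicits.
Arguments szero : clear implicits.
Arguments sd : clear implicits.

Definition norm (S : stability_setting) (x : hom term (sE S)) :
    hom (sE S) (sR S) :=
  sd S \o pair (idm (sE S)) (x \o bang (sE S)).

Definition order_preserving (C : category) (R : posetal_object C)
    (a : hom R R) : Prop :=
  forall (X : C) (f g : hom X R), f >== g -> a \o f >== a \o g.

Definition class_K (S : stability_setting) (a : hom (sR S) (sR S)) : Prop :=
  order_preserving a /\
  (exists b : hom (sR S) (sR S),
     order_preserving b /\ a \o b = idm (sR S) /\ b \o a = idm (sR S)) /\
  a \o szero S = szero S.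

Definition is_flow (S : stability_setting)
    (phi : hom (sT S \x sE S) (sE S)) : Prop :=
  phi \o pair (mon_unit (sT S) \o bang (sE S)) (idm (sE S)) = idm (sE S) /\
  phi \o prodm (mon_mul (sT S)) (idm (sE S))
  = phi \o prodm (idm (sT S)) phi \o assoc (C := S) (sT S) (sT S) (sE S).

Definition is_equilibrium (S : stability_setting)
    (phi : hom (sT S \x sE S) (sE S)) (x : hom term (sE S)) : Prop :=
  phi \o pair (idm (sT S)) (x \o bang (f := S) (sT S)) = x \o bang (f := S) (sT S).

Definition is_stable (S : stability_setting)
    (phi : hom (sT S \x sE S) (sE S)) (x : hom term (sE S)) : Prop :=
  exists a : hom (sR S) (sR S),
    class_K a /\ a \o norm x \o pr2 (f := S) (sT S) (sE S) >== norm x \o phi.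

Definition positive_definite (S : stability_setting)
    (x : hom term (sE S)) (V : hom (sE S) (sR S)) : Prop :=
  exists a_lo a_hi : hom (sR S) (sR S),
    class_K a_lo /\ class_K a_hi /\
    a_hi \o norm x >== V /\ V >== a_lo \o norm x.

Definition decrescent (S : stability_setting)
    (phi : hom (sT S \x sE S) (sE S)) (V : hom (sE S) (sR S)) : Prop :=
  V \o pr2 (f := S) (sT S) (sE S) >== V \o phi.

Definition is_lyapunov (S : stability_setting)
    (phi : hom (sT S \x sE S) (sE S)) (x : hom term (sE S))
    (V : hom (sE S) (sR S)) : Prop :=
  positive_definite x V /\ decrescent phi V.

Definition is_upper_bound (C : fp_category) (R : posetal_object C) (A B : C)
    (f : hom (A \x B) R) (beta : hom B R) : Prop :=
  beta \o pr2 A B >== f.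

Definition is_sup (C : fp_category) (R : posetal_object C) (A B : C)
    (f : hom (A \x B) R) (s : hom B R) : Prop :=
  is_upper_bound f s /\
  forall beta : hom B R, is_upper_bound f beta -> beta >== s.

Definition has_local_suprema (C : fp_category) (R : posetal_object C) : Prop :=
  forall (A B : C) (f : hom (A \x B) R),
    (exists beta : hom B R, is_upper_bound f beta) ->
    exists s : hom B R, is_sup f s.

(* Suprema are unique by antisymmetry, so the equation between two of them is
   stated for arbitrary s and s' that are the respective suprema; both exist
   when R has local suprema, since s \o r bounds the whiskered morphism. *)
Definition sup_commutes_with_whiskering (C : fp_category)
    (R : posetal_object C) : Prop :=
  forall (A B D : C) (f : hom (A \x B) R) (r : hom D B)
    (s : hom B R) (s' : hom D R),
    is_sup f s -> is_sup (f \o prodm (idm A) r) s' -> s \o r = s'.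

(* Main.v *)
Require Import Defs.
Local Open Scope cat_scope.

(** The Lyapunov morphism is the supremum of the norm along the orbit,
    V = sup_T (norm x \o phi).  Stability says exactly that, for some a
    of class K, [a \o norm x] is an upper bound of this family, so V exists and
    lies below [a \o norm x]; it lies above [norm x], with the identity as its
    class K bound, because the orbit of a point contains the point itself (unit
    law of the action).  Finally, the orbit of phi (t, e) is part of the
    orbit of e (associativity of the action), so the supremum cannot grow along
    the flow.  The last argument compares [V \o phi] with [V \o pr2], and
    [V \o phi] is known to be a supremum over the smaller orbit only because
    suprema commute with whiskering.

    The orbit argument is valid for any morphism f : E -> R in place of the
    norm: see [orbit_sup_ge] and [orbit_sup_decrescent]. *)

Section Products.

Variable C : fp_category.

Lemma pair_comp (W X A B : C) (f : hom X A) (g : hom X B) (h : hom W X) :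
  pair f g \o h = pair (f \o h) (g \o h).
Proof.
  apply pair_uniq; rewrite comp_assoc; [rewrite pr1_pair | rewrite pr2_pair];
    reflexivity.
Qed.

Lemma pair_eta (A B : C) : pair (pr1 A B) (pr2 A B) = idm (A \x B).
Proof. symmetry; apply pair_uniq; apply comp_idr. Qed.

Lemma pr2_prodm (A A' B B' : C) (f : hom A A') (g : hom B B') :
  pr2 A' B' \o prodm f g = g \o pr2 A B.
Proof. apply pr2_pair. Qed.

Definition assoc_inv (A B D : C) : hom (A \x (B \x D)) ((A \x B) \x D) :=
  pair (pair (pr1 A (B \x D)) (pr1 B D \o pr2 A (B \x D)))
       (pr2 B D \o pr2 A (B \x D)).

Lemma assoc_invK (A B D : C) :
  assoc A B D \o assoc_inv A B D = idm (A \x (B \x D)).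
Proof.
  unfold assoc, assoc_inv.
  rewrite !pair_comp, <- !comp_assoc, !pr1_pair, !pr2_pair.
  rewrite <- pair_comp, pair_eta, comp_idl; apply pair_eta.
Qed.

End Products.

Section OrbitSupremum.

Variables (C : fp_category) (R : posetal_object C) (T : internal_monoid C).
Variables (E : C) (phi : hom (T \x E) E).
Variables (f s : hom E R).

(** Restricting the upper-bound property to the neutral element of T. *)
Lemma orbit_sup_ge :
  phi \o pair (mon_unit T \o bang E) (idm E) = idm E ->
  is_sup (f \o phi) s -> s >== f.
Proof.
  intros act_unit [s_ub _].
  pose proof (ge_precomp (pair (mon_unit T \o bang E) (idm E)) s_ub) as s_ge.
  rewrite <- !comp_assoc, pr2_pair, act_unit, !comp_idr in s_ge.
  exact s_ge.
Qed.

(** Under f \o phi, the element (t', (t, e)) takes the same value at t' on the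
    orbit of phi (t, e) as (t' t, e) does on the orbit of e; so the bound s e
    for the latter orbit also bounds the former. *)
Lemma orbit_sup_bounds_shifted_orbit :
  phi \o prodm (mon_mul T) (idm E)
  = phi \o prodm (idm T) phi \o assoc T T E ->
  is_upper_bound (f \o phi) s ->
  is_upper_bound (f \o phi \o prodm (idm T) phi) (s \o pr2 T E).
Proof.
  intros act_mul s_ub; unfold is_upper_bound.
  assert (shift : phi \o (prodm (mon_mul T) (idm E) \o assoc_inv C T T E)
                  = phi \o prodm (idm T) phi).
  { rewrite comp_assoc, act_mul, <- !comp_assoc, assoc_invK, comp_idr.
    reflexivity. }
  pose proof (ge_precomp (prodm (mon_mul T) (idm E) \o assoc_inv C T T E) s_ub)
    as s_ge.
  rewrite <- !comp_assoc, shift in s_ge.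
  rewrite (comp_assoc (pr2 T E)), pr2_prodm, comp_idl in s_ge.
  unfold assoc_inv in s_ge; rewrite pr2_pair in s_ge.
  rewrite <- !comp_assoc; exact s_ge.
Qed.

(** By whiskering, s \o phi is the least upper bound over the shifted orbits,
    hence lies below the bound that the unshifted orbits provide. *)
Lemma orbit_sup_decrescent :
  has_local_suprema R -> sup_commutes_with_whiskering R ->
  phi \o prodm (mon_mul T) (idm E)
  = phi \o prodm (idm T) phi \o assoc T T E ->
  is_sup (f \o phi) s -> s \o pr2 T E >== s \o phi.
Proof.
  intros sup_ex sup_whisker act_mul s_sup.
  pose proof (orbit_sup_bounds_shifted_orbit act_mul (proj1 s_sup)) as shifted_ub.
  destruct (sup_ex _ _ _ (ex_intro _ _ shifted_ub)) as [s' s'_sup].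
  rewrite (sup_whisker _ _ _ _ _ _ _ s_sup s'_sup).
  exact (proj2 s'_sup _ shifted_ub).
Qed.

End OrbitSupremum.

Lemma class_K_id (S : stability_setting) : class_K (idm (sR S)).
Proof.
  assert (id_mono : order_preserving (idm (sR S))).
  { intros X f g f_ge_g; rewrite !comp_idl; exact f_ge_g. }
  split; [exact id_mono | split; [| apply comp_idl]].
  exists (idm (sR S)); split; [exact id_mono | split; apply comp_idl].
Qed.

Theorem theorem2 (S : stability_setting)
  (sup_ex : has_local_suprema (sR S))
  (sup_whisker : sup_commutes_with_whiskering (sR S))
  (phi : hom (sT S \x sE S) (sE S)) (phi_flow : is_flow phi)
  (x : hom term (sE S)) (x_eq : is_equilibrium phi x) :
  is_stable phi x ->
  exists V : hom (sE S) (sR S), is_lyapunov phi x V.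
Proof.
  intros [a [a_K a_ub]]; destruct phi_flow as [act_unit act_mul].
  destruct (sup_ex _ _ (norm x \o phi) (ex_intro _ (a \o norm x) a_ub))
    as [V V_sup].
  exists V; split.
  - exists (idm (sR S)), a.
    split; [apply class_K_id | split; [exact a_K | split]].
    + exact (proj2 V_sup _ a_ub).
    + rewrite comp_idl; exact (orbit_sup_ge _ _ _ _ _ _ _ act_unit V_sup).
  - exact (orbit_sup_decrescent _ _ _ _ _ _ _ sup_ex sup_whisker act_mul V_sup).
Qed.
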